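(* Consider algorithm TRIEST-BASE (described in the context) run with integer parameter $M\ge 6$ on an insertion-only edge stream. Let $t\ge 0$ and assume $|\Delta^{(t)}|>0$. For any $\varepsilon,\delta\in(0,1)$, let \[ \Phi=\sqrt[3]{8\varepsilon^{-2}\frac{3h^{(t)}+1}{|\Delta^{(t)}|}\ln\left(\frac{(3h^{(t)}+1)e}{\delta}\right)}. \] If \[ M\ge\max\left\{t\Phi\left(1+\tfrac{1}{2}\ln^{2/3}(t\Phi)\right),\ 12\varepsilon^{-1}+e^2,\ 25\right\}, \] then $\left|\xi^{(t)}\tau^{(t)}-|\Delta^{(t)}|\right|<\varepsilon|\Delta^{(t)}|$ with probability $>1-\delta$.
   Context: An insertion-only edge stream: at each time step $t=1,2,\dots$ an edge $e_t=\{u,v\}$ between two distinct vertices arrives, which is not already present; $G^{(t)}=(V^{(t)},E^{(t)})$ with $E^{(t)}=\{e_1,\dots,e_t\}$. A triangle in $G^{(t)}$ is a set of three edges $\{\{u,v\},\{v,w\},\{w,u\}\}\subseteq E^{(t)}$ with $u,v,w$ distinct; $\Delta^{(t)}$ is the set of all triangles of $G^{(t)}$, and $h^{(t)}$ is the maximum, over edges $e\in E^{(t)}$, of the number of triangles of $G^{(t)}$ containing $e$. TRIEST-BASE maintains an edge sample $\mathcal{S}$ (initially empty) by reservoir sampling with capacity $M$: at time $t$, if $t\le M$ the edge $e_t$ is inserted into $\mathcal{S}$; if $t>M$, with probability $M/t$ an edge chosen uniformly at random from $\mathcal{S}$ is removed and then $e_t$ is inserted, otherwise $\mathcal{S}$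 is unchanged. It maintains a counter $\tau$ (initially $0$): immediately after an edge $\{u,v\}$ is inserted into (resp. removed from) $\mathcal{S}$, $\tau$ is increased (resp. decreased) by the number of vertices $c$ such that both $\{c,u\}$ and $\{c,v\}$ are in the current $\mathcal{S}$. $\tau^{(t)}$ is the value of $\tau$ at the end of time step $t$. For positive integers $a\le\min\{M,b\}$, $\xi_{a,b}=1$ if $b\le M$ and $\xi_{a,b}=\prod_{i=0}^{a-1}\frac{b-i}{M-i}$ otherwise; $\xi^{(t)}=\xi_{3,t}$. *)

(* Defs.v *)
From Stdlib Require Import Reals.
From mathcomp Require Import ssreflect ssrfun ssrbool eqtype ssrnat seq.

Set Implicit Arguments.
Unset Strict Implicit.
Unset Printing Implicit Defensive.

(* Vertices are natural numbers; an (undirected) edge {u,v} is represented by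
   an ordered pair (u,v); (u,v) and (v,u) denote the same edge. *)
Definition edge := (nat * nat)%type.

Definition norm_edge (e : edge) : edge := (minn e.1 e.2, maxn e.1 e.2).

Definition wf_stream (s : seq edge) : bool :=
  all (fun e => e.1 != e.2) s && uniq (map norm_edge s).

Definition edge_in (S : seq edge) (x y : nat) : bool :=
  ((x, y) \in S) || ((y, x) \in S).

Definition verts (S : seq edge) : seq nat :=
  undup (flatten (map (fun e => [:: e.1; e.2]) S)).

Definition common (S : seq edge) (u v : nat) : nat :=
  count (fun c => edge_in S c u && edge_in S c v) (verts S).

Definition num_tri (E : seq edge) : nat :=
  let V := verts E in
  count (fun x : nat * (nat * nat) =>
           let: (a, (b, c)) := x in
           [&& a < b, b < c, edge_in E a b, edge_in E b c & edge_in E a c])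
        (flatten [seq [seq (a, bc) | bc <- [seq (b, c) | b <- V, c <- V]] | a <- V]).

Definition tri_of_edge (E : seq edge) (e : edge) : nat :=
  count (fun c => edge_in E c e.1 && edge_in E c e.2) (verts E).

Definition hmax (E : seq edge) : nat :=
  foldr maxn 0 (map (tri_of_edge E) E).

Definition xi_ab (M a b : nat) : R :=
  if (b <= M)%N then 1%R
  else foldr Rmult 1%R
         (map (fun i => (INR (b - i) / INR (M - i))%R) (iota 0 a)).

Definition xi (M t : nat) : R := xi_ab M 3 t.

(* state = (sample S, counter tau) *)
Definition state := (seq edge * R)%type.
(* a finitely supported distribution: list of (probability, state) *)
Definition dist := seq (R * state).

Definition ins (e : edge) (st : state) : state :=
  let S' := rcons st.1 e in (S', (st.2 + INR (common S' e.1 e.2))%R).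

Definition rem_at (i : nat) (st : state) : state :=
  let f := nth (0, 0) st.1 i in
  let S' := take i st.1 ++ drop i.+1 st.1 in
  (S', (st.2 - INR (common S' f.1 f.2))%R).

(* one step at time t (1-based) with arriving edge e, from a given state *)
Definition step1 (M t : nat) (e : edge) (st : state) : dist :=
  if (t <= M)%N then [:: (1%R, ins e st)]
  else
    ((1 - INR M / INR t)%R, st) ::
    map (fun i => (((INR M / INR t) * (1 / INR (size st.1)))%R,
                  ins e (rem_at i st)))
        (iota 0 (size st.1)).

Definition step (M t : nat) (e : edge) (d : dist) : dist :=
  flatten (map (fun ps =>
     map (fun qs => ((ps.1 * qs.1)%R, qs.2)) (step1 M t e ps.2)) d).

Fixpoint run_from (M t : nat) (s : seq edge) (d : dist) : dist :=
  match s with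
  | [::] => d
  | e :: s' => run_from M t.+1 s' (step M t.+1 e d)
  end.

Definition triest_base (M : nat) (s : seq edge) : dist :=
  run_from M 0 s [:: (1%R, ([::], 0%R))].

Definition prob (d : dist) (P : state -> bool) : R :=
  foldr Rplus 0%R (map (fun ps => if P ps.2 then ps.1 else 0%R) d).

Definition Rltb (x y : R) : bool := if Rlt_dec x y then true else false.

(* Main.v *)
(* The reservoir is at every time an exactly uniform M-subset of the edges seen,
   and the counter is its number of triangles.  Triangles of the graph conflict
   when they share an edge; each conflicts with at most 3h of them, itself
   included, so K = 3h + 1 colours suffice for a greedy colouring whose classes
   consist of edge-disjoint triangles.  Inside a class the inclusion indicators
   are negatively associated, hence their sum has a moment generating function
   bounded by that of independent indicators.  Hoelder's inequality over the K
   classes then gives both Chernoff tails, with exponent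
   5/32 eps^2 q T / K where 1/q = xi and T is the number of triangles; no
   comparison with independent edge sampling is needed.  The tails are at most
   delta / (K e) each, because M >= t Phi and q >= 0.88 (M/t)^3. *)
Require Import Defs.
From Stdlib Require Import Reals Lra Psatz.
From HB Require Import structures.
From mathcomp Require Import ssreflect ssrfun ssrbool eqtype ssrnat seq.
From mathcomp Require Import path bigop zify.

Set Implicit Arguments.
Unset Strict Implicit.
Unset Printing Implicit Defensive.

(** * Finite sums of real numbers *)

HB.instance Definition _ := Monoid.isComLaw.Build R 0%R Rplus
  (fun x y z => esym (Rplus_assoc x y z)) Rplus_comm Rplus_0_l.

Local Notation "\rsum_ ( i <- r ) F" := (\big[Rplus/0%R]_(i <- r) F%R)
  (at level 36, F at level 36, i at level 0, r at level 50).

Lemma rsum_scal (I : Type) (r : seq I) (c : R) (F : I -> R) :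
  (\rsum_(i <- r) (c * F i) = c * \rsum_(i <- r) F i)%R.
Proof.
elim: r => [|i r IH]; first by rewrite !big_nil Rmult_0_r.
by rewrite !big_cons IH Rmult_plus_distr_l.
Qed.

Lemma rsum_le (I : eqType) (r : seq I) (F G : I -> R) :
  (forall i, i \in r -> (F i <= G i)%R) -> (\rsum_(i <- r) F i <= \rsum_(i <- r) G i)%R.
Proof.
elim: r => [|i r IH] h; first by rewrite !big_nil; lra.
rewrite !big_cons; apply: Rplus_le_compat; first by apply: h; rewrite mem_head.
by apply: IH => j jr; apply: h; rewrite in_cons jr orbT.
Qed.

Lemma rsum_const (I : Type) (r : seq I) (c : R) :
  (\rsum_(i <- r) c = INR (size r) * c)%R.
Proof.
elim: r => [|i r IH]; first by rewrite big_nil Rmult_0_l.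
by rewrite big_cons IH [size (_ :: _)]/= S_INR; ring.
Qed.

Lemma INR_leq (m n : nat) : (m <= n)%N -> (INR m <= INR n)%R.
Proof. by move=> /leP; apply: le_INR. Qed.

Lemma INR_sum (I : Type) (r : seq I) (F : I -> nat) :
  INR (\sum_(i <- r) F i) = \rsum_(i <- r) INR (F i).
Proof.
elim: r => [|i r IH]; first by rewrite !big_nil.
by rewrite !big_cons plus_INR IH.
Qed.

Local Arguments INR : simpl never.

(** * Uniform random subsequences of fixed size *)

Section UniformSubsequence.

Variable T : eqType.
Implicit Types (s A : seq T) (f g : seq T -> R) (k : nat).

(* Expectation of [f] over a uniformly random [k]-element subsequence of [s]:
   the head of [s] is selected with probability [k / size s]. *)
Fixpoint unif k s f : R :=
  match s with
  | [::] => f [::]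
  | e :: s' =>
      (INR k / INR (size s) * unif k.-1 s' (fun A => f (e :: A))
       + (1 - INR k / INR (size s)) * unif k s' f)%R
  end.

Lemma weight_bounds k n : (k <= n.+1)%N -> (0 <= INR k / INR n.+1 <= 1)%R.
Proof.
move=> h; have n0 : (0 < INR n.+1)%R by apply: lt_0_INR; apply/leP.
have k0 := pos_INR k; have kn := INR_leq h.
split; first by apply: Rle_mult_inv_pos.
by apply: (Rmult_le_reg_r (INR n.+1)) => //; field_simplify; lra.
Qed.

Lemma unif_consE k e s f : unif k (e :: s) f =
  (INR k / INR (size s).+1 * unif k.-1 s (fun A => f (e :: A))
   + (1 - INR k / INR (size s).+1) * unif k s f)%R.
Proof. by []. Qed.

Lemma unif_cons0 e s f : unif 0 (e :: s) f = unif 0 s f.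
Proof. by rewrite unif_consE INR_0 /Rdiv; ring. Qed.

Lemma unif_cons_full e s f :
  unif (size s).+1 (e :: s) f = unif (size s) s (fun A => f (e :: A)).
Proof.
rewrite unif_consE [_.-1]/= /Rdiv Rinv_r; first by ring.
by apply: not_0_INR.
Qed.

Lemma unif_full s f : unif (size s) s f = f s.
Proof. by elim: s f => [//|e s IH] f; rewrite [size _]/= unif_cons_full IH. Qed.

Lemma unif_le k s f g : (k <= size s)%N ->
  (forall A, subseq A s -> size A = k -> (f A <= g A)%R) ->
  (unif k s f <= unif k s g)%R.
Proof.
elim: s k f g => [|e s IH] k f g.
  by rewrite leqn0 => /eqP -> h; apply: h.
have sub A : subseq A s -> subseq A (e :: s).
  by move/subseq_trans; apply; apply: subseq_cons.
case: k => [_ h|k]; first by rewrite !unif_cons0; apply: IH => // A /sub; apply: h.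
(* When the whole list is selected, skipping the head has weight 0 but would ask for more elements
   than remain, beyond the reach of the induction hypothesis. This boundary case is split off here
   and in the lemmas below. *)
rewrite [size _]/= ltnS leq_eqVlt => /orP [/eqP -> h|ks h].
  rewrite !unif_cons_full; apply: IH => // A sA szA.
  by apply: h; rewrite /= ?eqxx ?szA.
have [w0 w1] : (0 <= INR k.+1 / INR (size s).+1 <= 1)%R.
  by apply: weight_bounds; rewrite ltnS ltnW.
rewrite !unif_consE [_.-1]/=.
apply: Rplus_le_compat; apply: Rmult_le_compat_l; try lra.
  by apply: (IH _ _ _ (ltnW ks)) => A sA szA; apply: h; rewrite /= ?eqxx ?szA.
by apply: (IH _ _ _ ks) => A /sub sA szA; apply: h.
Qed.

Lemma unif_eq k s f g : (k <= size s)%N ->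
  (forall A, subseq A s -> size A = k -> f A = g A) ->
  unif k s f = unif k s g.
Proof.
by move=> ks h; apply: Rle_antisym; apply: unif_le => // A sA szA; rewrite h //; lra.
Qed.

Lemma unif_ext k s f g : f =1 g -> unif k s f = unif k s g.
Proof.
elim: s k f g => [|e s IH] k f g h //=.
by rewrite (IH _ f g) // (IH _ (fun A => f (e :: A)) (fun A => g (e :: A))).
Qed.

Lemma unifD k s f g :
  unif k s (fun A => f A + g A)%R = (unif k s f + unif k s g)%R.
Proof. by elim: s k f g => [|e s IH] k f g //=; rewrite !IH; ring. Qed.

Lemma unifZ k s c f : unif k s (fun A => c * f A)%R = (c * unif k s f)%R.
Proof. by elim: s k f => [|e s IH] k f //=; rewrite !IH; ring. Qed.

Lemma unif_const k s c : unif k s (fun=> c) = c.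
Proof. by elim: s k => [|e s IH] k //=; rewrite !IH; ring. Qed.

Lemma unif_rsum k s (I : Type) (r : seq I) (F : I -> seq T -> R) :
  unif k s (fun A => \rsum_(i <- r) F i A) = \rsum_(i <- r) unif k s (F i).
Proof.
elim: r => [|i r IH].
  by rewrite big_nil -[RHS](unif_const k s); apply: unif_ext => A; rewrite big_nil.
by rewrite big_cons -IH -unifD; apply: unif_ext => A; rewrite big_cons.
Qed.

Lemma unif0 s f : unif 0 s f = f [::].
Proof. by elim: s f => [|e s IH] f //; rewrite unif_cons0. Qed.

(** The recursion conditions on the head only; this conditions on an element at any position, [g]
    being [f] once that element is known to be selected. Induction on [s1]: the joint weights of the
    choices for [x] and [e] are symmetric, so the order of conditioning can be exchanged. *)
Lemma unif_insert k s1 e s2 f g : (k <= (size s1 + size s2).+1)%N ->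
  (forall A1 A2, subseq A1 s1 -> subseq A2 s2 -> f (A1 ++ e :: A2) = g (A1 ++ A2)) ->
  unif k (s1 ++ e :: s2) f
  = (INR k / INR (size s1 + size s2).+1 * unif k.-1 (s1 ++ s2) g
     + (1 - INR k / INR (size s1 + size s2).+1) * unif k (s1 ++ s2) f)%R.
Proof.
elim: s1 k f g => [|x s1 IH] k f g.
  case: k => [|k] ks h; first by rewrite !unif0 INR_0 /Rdiv; ring.
  rewrite cat0s unif_consE add0n (@unif_eq k s2 _ g) //.
  by move=> A sA _; apply: (h [::] A).
case: k => [|k] ks h; first by rewrite !unif0 INR_0 /Rdiv; ring.
have n0 : INR (size (x :: s1) + size s2).+1 <> 0%R by apply: not_0_INR.
move: ks; rewrite ltnS leq_eqVlt => /orP [/eqP kE|ks].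
  have szE : size ((x :: s1) ++ e :: s2) = k.+1 by rewrite size_cat /= kE /=; lia.
  have -> : unif k.+1 ((x :: s1) ++ e :: s2) f = g ((x :: s1) ++ s2).
    by rewrite -szE unif_full h ?subseq_refl.
  have gE : unif k ((x :: s1) ++ s2) g = g ((x :: s1) ++ s2).
    by rewrite kE -size_cat unif_full.
  by rewrite -kE succnK gE; rewrite -kE in n0; field.
have {}n0 : INR (size s1 + size s2).+1 <> 0%R by apply: not_0_INR.
have n1 : INR (size s1 + size s2).+2 <> 0%R by apply: not_0_INR.
rewrite !cat_cons !unif_consE (IH k.+1 f g) //=; last first.
  by move=> A1 A2 sA1; apply: h; apply: subseq_trans sA1 (subseq_cons _ _).
rewrite (IH k (fun A => f (x :: A)) (fun A => g (x :: A))); last first.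
- by move=> A1 A2 sA1; apply: (h (x :: A1)); rewrite /= eqxx.
- by move: ks => /=; lia.
rewrite !size_cat [size (e :: s2)]/= !addnS !addSn.
by move: n0 n1; rewrite !S_INR => n0 n1; field.
Qed.

(* Deleting a uniform element from a uniform [k.+1]-subset leaves a uniform
   [k]-subset. *)
Lemma unif_delete k s g : (k < size s)%N ->
  unif k.+1 s (fun A => \rsum_(i <- iota 0 (size A)) g (take i A ++ drop i.+1 A))
  = (INR k.+1 * unif k s g)%R.
Proof.
elim: s k g => [//|e s IH] k g; rewrite [size _]/= ltnS => ks.
(* Position 0 deletes [e] itself; deletions at later positions keep [e] in front, which is the shape
   the induction hypothesis expects. *)
have del A : (\rsum_(i <- iota 0 (size (e :: A))) g (take i (e :: A) ++ drop i.+1 (e :: A))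
   = g A + \rsum_(i <- iota 0 (size A)) g (e :: (take i A ++ drop i.+1 A)))%R.
  by rewrite [iota _ _]/= big_cons /= drop0 (iotaDl 1 0) big_map.
rewrite unif_consE (unif_ext _ _ del) unifD.
have n0 : INR (size s).+1 <> 0%R by apply: not_0_INR.
have -> : unif k s (fun A => \rsum_(i <- iota 0 (size A)) g (e :: (take i A ++ drop i.+1 A)))
          = (INR k * unif k.-1 s (fun A => g (e :: A)))%R.
  case: k ks => [|k] ks; first by rewrite unif0 big_nil INR_0 Rmult_0_l.
  exact: (IH k (fun A => g (e :: A)) ks).
rewrite unif_consE succnK; case: (leqP (size s) k) => [sk|ks'].
  have -> : k = size s by apply/eqP; rewrite eqn_leq ks.
  by move: n0; rewrite S_INR => n0; field.
by rewrite IH //; move: n0; rewrite !S_INR => n0; field.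
Qed.

End UniformSubsequence.

Lemma unif_map (T U : eqType) (h : T -> U) k (s : seq T) (f : seq U -> R) :
  unif k (map h s) f = unif k s (fun A => f (map h A)).
Proof. by elim: s k f => [//|e s IH] k f /=; rewrite !IH size_map. Qed.

(** * Negative dependence *)

Lemma exp_mono x y : (x <= y)%R -> (exp x <= exp y)%R.
Proof. by case=> [/exp_increasing|->]; lra. Qed.

Section NegativeDependence.

Variable T : eqType.
Implicit Types (s A B l : seq T) (Z : seq T -> R) (k j n : nat).

Definition increasing Z := forall A B, {subset A <= B} -> (Z A <= Z B)%R.

(** Coupling: a uniform [k]-subset is a uniform [k.+1]-subset with one random element deleted, and
    the deletion can only lower [Z]. *)
Lemma unif_mono k s Z : increasing Z -> (k < size s)%N ->
  (unif k s Z <= unif k.+1 s Z)%R.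
Proof.
move=> Zi ks; have k0 : (0 < INR k.+1)%R by apply: lt_0_INR; apply/leP.
apply: (Rmult_le_reg_l _ _ _ k0); rewrite -unif_delete // -unifZ.
apply: unif_le => // A _ <-; rewrite -{2}(size_iota 0 (size A)) -rsum_const.
apply: rsum_le => i _; apply: Zi => x; rewrite mem_cat.
by case/orP; [apply: mem_take | apply: mem_drop].
Qed.

(* Probability that [j] given elements all belong to a uniform [k]-subset of an
   [n]-set. *)
Fixpoint incl_prob j k n : R :=
  if j is j'.+1 then (INR k / INR n * incl_prob j' k.-1 n.-1)%R else 1%R.

Lemma incl_prob_ge0 j k n : (0 <= incl_prob j k n)%R.
Proof.
elim: j k n => [|j IH] k n /=; first lra.
apply: Rmult_le_pos (IH _ _); have k0 := pos_INR k.
(* The inverse of 0 is 0, so an empty ground set gives weight 0. *)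
case: n => [|n]; first by rewrite INR_0 /Rdiv Rinv_0; lra.
by apply: Rle_mult_inv_pos => //; apply: lt_0_INR; apply/leP.
Qed.

(** Negative correlation, one element of [l] at a time. Once [e] is selected there is one draw fewer
    from the other elements; since [Z] is increasing and blind to [e], its mean there is at most its
    overall mean. *)
Lemma unif_incl_le l k s Z : increasing Z ->
  (forall e A, e \in l -> Z (e :: A) = Z A) ->
  uniq s -> uniq l -> {subset l <= s} -> (size l <= k <= size s)%N ->
  (unif k s (fun A => Z A * INR (all (mem A) l))
   <= incl_prob (size l) k (size s) * unif k s Z)%R.
Proof.
move=> Zi; elim: l k s => [|e l IH] k s Zl us ul ls /andP [lk ks].
  rewrite Rmult_1_l; apply: Req_le; apply: unif_ext => A.
  by rewrite /= Rmult_1_r.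
have es : e \in s by apply: ls; rewrite mem_head.
case/splitPr: es us ls ks => s1 s2 us ls ks.
have [er ur] : e \notin s1 ++ s2 /\ uniq (s1 ++ s2).
  by move: us; rewrite -cat1s uniq_catCA cat1s /= => /andP [].
have szE : size (s1 ++ e :: s2) = (size (s1 ++ s2)).+1 by rewrite !size_cat addnS.
case: k lk ks => [//|k] lk; rewrite szE ltnS => ks.
move: ul; rewrite [uniq _]/= => /andP [el ul].
have Ze A1 A2 : Z (A1 ++ e :: A2) = Z (A1 ++ A2).
  rewrite -(Zl e (A1 ++ A2)) ?mem_head //; apply: Rle_antisym; apply: Zi => x;
    by rewrite !(mem_cat, in_cons) orbCA.
rewrite (@unif_insert _ k.+1 s1 e s2 _ (fun A => Z A * INR (all (mem A) l))%R); first last.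
- move=> A1 A2 _ _; rewrite Ze; congr (_ * INR _)%R; congr nat_of_bool.
  rewrite /= mem_cat mem_head orbT /=; apply: eq_in_all => x xl /=.
  by rewrite !mem_cat in_cons; case: eqP xl el => [->|//] ->.
- by rewrite -size_cat.
have insZ := @unif_insert _ k.+1 s1 e s2 Z Z _ (fun A1 A2 _ _ => Ze A1 A2).
rewrite {}insZ -?size_cat //.
set w := (INR k.+1 / _)%R.
have [w0 w1] : (0 <= w <= 1)%R by apply: weight_bounds.
(* A sample that misses [e] cannot contain all of [e :: l], so only the branch selecting [e]
   survives. *)
have -> : ((1 - w) * unif k.+1 (s1 ++ s2) (fun A => Z A * INR (all (mem A) (e :: l)))
           = 0)%R.
  move: ks; rewrite leq_eqVlt => /orP [/eqP kE|ks].
    by rewrite /w kE /Rdiv Rinv_r ?Rminus_diag ?Rmult_0_l //; apply: not_0_INR.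
  rewrite (@unif_eq _ _ _ _ (fun=> 0%R)) ?unif_const ?Rmult_0_r // => A sA _ /=.
  by rewrite (negbTE (contra (@mem_subseq _ _ _ sA e) er)) INR_0 Rmult_0_r.
have mono : ((1 - w) * unif k (s1 ++ s2) Z <= (1 - w) * unif k.+1 (s1 ++ s2) Z)%R.
  move: ks; rewrite leq_eqVlt => /orP [/eqP kE|ks].
    by rewrite /w kE /Rdiv Rinv_r ?Rminus_diag ?Rmult_0_l; [lra|apply: not_0_INR].
  by apply: Rmult_le_compat_l; [lra|apply: unif_mono].
have p0 := incl_prob_ge0 (size l) k (size (s1 ++ s2)).
have IH' : (unif k (s1 ++ s2) (fun A => Z A * INR (all (mem A) l))
   <= incl_prob (size l) k (size (s1 ++ s2)) * unif k (s1 ++ s2) Z)%R.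
  apply: IH => //; last by rewrite -ltnS lk.
    by move=> x A xl; apply: Zl; rewrite in_cons xl orbT.
  move=> x xl; have := ls x; rewrite in_cons xl orbT => /(_ isT).
  by rewrite !mem_cat in_cons; case: eqP xl el => [->|//] ->.
rewrite [incl_prob _ _ _]/= -/w Rplus_0_r Rmult_assoc.
apply: Rmult_le_compat_l => //; apply: Rle_trans IH' _.
by apply: Rmult_le_compat_l => //; rewrite succnK; lra.
Qed.

(** Peels off one member [l]: its exponential factor is 1 plus [exp v - 1] times its indicator,
    negative correlation bounds the mixed term, and [1 + x <= exp x] restores the exponential.
    Disjointness makes the remaining factor blind to the elements of [l]. *)
Lemma unif_mgf_disjoint (L : seq (seq T)) (v : R) j k s :
  uniq s -> (j <= k <= size s)%N -> uniq L ->
  (forall l, l \in L -> [/\ uniq l, {subset l <= s} & size l = j]) ->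
  {in L &, forall l l', l != l' -> ~~ has (mem l) l'} ->
  (unif k s (fun A => exp (v * INR (count (all (mem A)) L)))
   <= exp (INR (size L) * (incl_prob j k (size s) * (exp v - 1))))%R.
Proof.
move=> us /andP [jk ks]; elim: L => [|l L IH] uL hL dL.
  rewrite /= INR_0 Rmult_0_l exp_0.
  rewrite (unif_ext _ _ (g := fun=> 1%R)) ?unif_const; first lra.
  by move=> A; rewrite Rmult_0_r exp_0.
have [ul ls lj] := hL l (mem_head _ _).
move: uL => /= /andP [lL uL].
pose Y A := exp (v * INR (count (all (mem A)) L)).
have {}IH : (unif k s Y <= exp (INR (size L) * (incl_prob j k (size s) * (exp v - 1))))%R.
  apply: IH => // [l' l'L|l1 l2 l1L l2L]; first by apply: hL; rewrite in_cons l'L orbT.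
  by apply: dL; rewrite in_cons ?l1L ?l2L orbT.
set q := incl_prob j k (size s) in IH *.
(* Absorbing the factor [exp v - 1] makes [Z] increasing for both signs of [v]: when [v < 0], [Y]
   decreases and the factor is negative. Hence one argument serves both tails. *)
pose Z A := ((exp v - 1) * Y A)%R.
have Zi : increasing Z.
  move=> A B AB; have cAB : (INR (count (all (mem A)) L) <= INR (count (all (mem B)) L))%R.
    by apply: INR_leq; apply: sub_count => l'; apply: sub_all.
  have [v0|v0] : (0 <= v \/ v < 0)%R by lra.
    have e0 : (0 <= exp v - 1)%R by have := exp_ineq1_le v; lra.
    by apply: Rmult_le_compat_l => //; apply: exp_mono; apply: Rmult_le_compat_l.
  have e0 : (exp v - 1 <= 0)%R by have := exp_increasing _ _ v0; rewrite exp_0; lra.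
  apply: Rmult_le_compat_neg_l => //; apply: exp_mono.
  by apply: Rmult_le_compat_neg_l => //; lra.
have Zl e A : e \in l -> Z (e :: A) = Z A.
  move=> el; rewrite /Z /Y; congr (_ * exp (_ * INR _))%R.
  apply: eq_in_count => l' l'L; apply: eq_in_all => x xl' /=; rewrite in_cons.
  case: eqP => [xe|//]; have /negP[] : ~~ has (mem l) l'.
    apply: dL; rewrite ?mem_head ?in_cons ?l'L ?orbT //.
    by apply: contraNneq lL => ->.
  by apply/hasP; exists x; rewrite // xe.
have key := @unif_incl_le l k s Z Zi Zl us ul ls.
rewrite lj jk ks in key; move: {key}(key isT); rewrite -/q => key.
have Y0 : (0 <= unif k s Y)%R.
  rewrite -(unif_const k s 0%R); apply: unif_le => // A _ _.
  exact: Rlt_le (exp_pos _).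
rewrite (unif_ext _ _ (g := fun A => (Y A + Z A * INR (all (mem A) l))%R)); last first.
  move=> A; rewrite /Z /Y /=; case: (all _ l); last by rewrite add0n INR_0; ring.
  by rewrite plus_INR Rmult_plus_distr_l exp_plus INR_1 Rmult_1_r; ring.
rewrite unifD; move: key; rewrite unifZ => key.
rewrite S_INR Rmult_plus_distr_r Rmult_1_l exp_plus.
apply: (@Rle_trans _ (unif k s Y * exp (q * (exp v - 1)))).
  have := exp_ineq1_le (q * (exp v - 1)); nra.
by apply: Rmult_le_compat_r => //; apply: Rlt_le; apply: exp_pos.
Qed.

End NegativeDependence.

(** * Colouring and concentration *)

(** Vertices are coloured one at a time. By reflexivity the count for [x] includes [x] itself, so
    its coloured neighbours block fewer than [K] colours. *)
Lemma greedy_coloring (T : eqType) (conf : rel T) (K : nat) (L : seq T) :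
  symmetric conf -> uniq L ->
  (forall x, x \in L -> conf x x) ->
  (forall x, x \in L -> count (conf x) L <= K)%N ->
  exists2 col : T -> nat, (forall x, x \in L -> (col x < K)%N) &
    {in L &, forall x y, x != y -> conf x y -> col x != col y}.
Proof.
move=> csym; elim: L => [|x L IH] uL cL dL; first by exists (fun=> 0%N).
move: uL => /= /andP [xL uL].
have [|| col colK colP] := IH uL.
- by move=> y yL; apply: cL; rewrite in_cons yL orbT.
- move=> y yL; apply: leq_trans (dL y _); last by rewrite in_cons yL orbT.
  by rewrite /= leq_addl.
pose used := map col (filter (conf x) L).
have [c cK cU] : exists2 c, (c < K)%N & c \notin used.
  have /hasP [c] : has (fun c => c \notin used) (iota 0 K).
    rewrite has_predC; apply/negP => /allP sub.
    have := uniq_leq_size (iota_uniq 0 K) sub.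
    rewrite size_iota size_map size_filter => le.
    by have := dL x (mem_head _ _); rewrite /= cL ?mem_head //; lia.
  by rewrite mem_iota => cK cU; exists c.
exists (fun y => if y == x then c else col y) => [y|y z].
  by rewrite in_cons; case: eqP => [_ _ //|_ /=]; apply: colK.
have free w : w \in L -> conf x w -> c != col w.
  move=> wL xw; apply: contraNneq cU => ->.
  by apply: map_f; rewrite mem_filter xw.
rewrite !in_cons; case: (y =P x) => [->|_]; case: (z =P x) => [->|_] //=.
- by rewrite eqxx.
- by move=> _ zL _; apply: free.
- by move=> yL _ _; rewrite csym eq_sym; apply: free.
- exact: colP.
Qed.

(** The tangent at the mean [m] gives [exp y >= exp m * (1 + y - m)]; averaging over [r] removes the
    linear term. *)
Lemma exp_jensen (I : eqType) (r : seq I) (y : I -> R) : (0 < size r)%N ->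
  (exp ((\rsum_(i <- r) y i) / INR (size r))
   <= / INR (size r) * \rsum_(i <- r) exp (y i))%R.
Proof.
move=> r0; have K0 : (0 < INR (size r))%R by apply: lt_0_INR; apply/ltP.
set S := \big[_/_]_(i <- r) y i; set m := (S / INR (size r))%R.
have tangent : (\rsum_(i <- r) (exp m * (1 - m) + exp m * y i)
                <= \rsum_(i <- r) exp (y i))%R.
  apply: rsum_le => i _; have := exp_ineq1_le (y i - m).
  have -> : exp (y i) = (exp m * exp (y i - m))%R by rewrite -exp_plus; congr exp; lra.
  by have := exp_pos m; nra.
move: tangent; rewrite big_split rsum_const rsum_scal -/S /=.
have -> : S = (INR (size r) * m)%R by rewrite /m; field; lra.
move=> tangent; apply: (Rmult_le_reg_l _ _ _ K0).
by rewrite -Rmult_assoc Rinv_r ?Rmult_1_l /=; lra.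
Qed.

Lemma count_color (T : Type) (P : pred T) (col : T -> nat) K (L : seq T) :
  all (fun x => (col x < K)%N) L ->
  count P L = (\sum_(c <- iota 0 K) count P (filter (fun x => col x == c) L))%N.
Proof.
elim: L => [|x L IH] /=; first by rewrite big1_seq.
move=> /andP [xK LK]; rewrite (IH LK).
rewrite [RHS](eq_bigr (fun c => ((col x == c) && P x) +
   count P [seq x0 <- L | col x0 == c])%N); last first.
  by move=> c _ /=; case: (col x == c).
rewrite big_split /=; congr addn.
have mK : col x \in iota 0 K by rewrite mem_iota.
rewrite (bigD1_seq (col x)) ?iota_uniq //= eqxx big1 ?addn0 //.
by move=> c; rewrite eq_sym => /negbTE ->.
Qed.

Section Concentration.

Variable T : eqType.
Variables (s : seq T) (L : seq (seq T)) (j k K : nat).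
Hypotheses (us : uniq s) (jks : (j <= k <= size s)%N) (j0 : (0 < j)%N) (K0 : (0 < K)%N).
Hypothesis uL : uniq L.
Hypothesis hL : forall l, l \in L -> [/\ uniq l, {subset l <= s} & size l = j].
Hypothesis degL : forall l, l \in L -> (count (fun l' => has (mem l) l') L <= K)%N.

Let X (A : seq T) := INR (count (all (mem A)) L).
Let q := incl_prob j k (size s).

(* Hoelder's inequality over the [K] colour classes, inside each of which the
   members of [L] are disjoint. *)
Lemma unif_mgf (u : R) :
  (unif k s (fun A => exp (u * X A))
   <= exp (INR (size L) / INR K * (q * (exp (INR K * u) - 1))))%R.
Proof.
have Kpos : (0 < INR K)%R by apply: lt_0_INR; apply/ltP.
have [|||col colK colP] := @greedy_coloring _ (fun l l' : seq T => has (mem l) l') K L _ uL.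
- by move=> l l'; apply: has_sym.
- move=> l lL; have [_ _ sl] := hL lL; case: l sl {lL} => [|x l] sl.
    by move: j0; rewrite -sl.
  by rewrite /= mem_head.
- exact: degL.
pose cls c := filter (fun l => col l == c) L.
pose b := (q * (exp (INR K * u) - 1))%R.
have allK : all (fun l => (col l < K)%N) L by apply/allP.
(* [u * X A] is the average over the colours of [INR K * u] times the count in each class.
   Subtracting [b] per member normalises each class exponential to mean at most 1, so that Jensen's
   inequality does the work of Hoelder's. *)
pose y (A : seq T) (c : nat) := (INR K * u * INR (count (all (mem A)) (cls c))
               + (- b * INR (size (cls c))))%R.
have ysum (A : seq T) : (\rsum_(c <- iota 0 K) y A c = INR K * (u * X A + - (INR (size L) / INR K * b)))%R.
  rewrite big_split !rsum_scal -!INR_sum -(count_color _ allK) /=.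
  have -> : (\sum_(c <- iota 0 K) size (cls c) = size L)%N.
    rewrite -(count_predT L) (count_color predT allK).
    by apply: eq_bigr => c _; rewrite count_predT.
  by rewrite -/(X A); field; lra.
have jensen (A : seq T) : (exp (u * X A + - (INR (size L) / INR K * b))
                 <= / INR K * \rsum_(c <- iota 0 K) exp (y A c))%R.
  have := @exp_jensen _ (iota 0 K) (y A); rewrite size_iota ysum => /(_ K0).
  by congr (exp _ <= _)%R; field; lra.
have class c : (unif k s (fun A => exp (y A c)) <= 1)%R.
  rewrite (unif_ext _ _ (g := fun A => exp (- b * INR (size (cls c)))
      * exp (INR K * u * INR (count (all (mem A)) (cls c))))%R); last first.
    by move=> A; rewrite /y exp_plus Rmult_comm.
  have h : (unif k s (fun A => exp (INR K * u * INR (count (all (mem A)) (cls c))))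
            <= exp (INR (size (cls c)) * b))%R.
    apply: unif_mgf_disjoint => //; first exact: filter_uniq.
      by move=> l; rewrite mem_filter => /andP [_]; apply: hL.
    move=> l l'; rewrite !mem_filter => /andP [/eqP cl lL] /andP [/eqP cl' l'L] ne.
    by apply/negP => /(colP l l' lL l'L ne); rewrite cl cl' eqxx.
  rewrite unifZ.
  have -> : 1%R = (exp (- b * INR (size (cls c))) * exp (INR (size (cls c)) * b))%R.
    by rewrite -exp_plus -exp_0; congr exp; ring.
  by apply: Rmult_le_compat_l => //; apply: Rlt_le; apply: exp_pos.
have [_ ks] := andP jks.
have := unif_le ks (fun A _ _ => jensen A).
rewrite unifZ unif_rsum (unif_ext _ _ (g := fun A =>
   exp (- (INR (size L) / INR K * b)) * exp (u * X A))%R); last first.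
  by move=> A; rewrite exp_plus Rmult_comm.
rewrite unifZ exp_Ropp => h.
have {}h : (/ exp (INR (size L) / INR K * b) * unif k s (fun A => exp (u * X A)) <= 1)%R.
  apply: Rle_trans h _; apply: (@Rle_trans _ (/ INR K * \rsum_(c <- iota 0 K) 1)).
    apply: Rmult_le_compat_l; first by apply: Rlt_le; apply: Rinv_0_lt_compat.
    by apply: rsum_le => c _; apply: class.
  by rewrite rsum_const size_iota Rmult_1_r Rinv_l; lra.
have e0 := exp_pos (INR (size L) / INR K * b).
apply: (Rmult_le_reg_l (/ exp (INR (size L) / INR K * b))); first exact: Rinv_0_lt_compat.
by rewrite -/b Rinv_l; lra.
Qed.

(** From [exp (- v) >= 1 - v] follows [exp v * (1 - v) <= 1], while the quadratic times [1 - v]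
    equals [1 + v ^ 2 * (3 - 8 * v) / 5], which is at least 1 for [v <= 3 / 8]. *)
Lemma exp_quadratic_bound v : (v <= 3 / 8)%R -> (exp v <= 1 + v + 8 / 5 * v ^ 2)%R.
Proof.
move=> hv; have := exp_ineq1_le (- v); rewrite exp_Ropp => h.
have e0 := exp_pos v.
have {}h : (exp v * (1 - v) <= 1)%R.
  have := Rmult_le_compat_l _ _ _ (Rlt_le _ _ e0) h; rewrite Rinv_r; lra.
have : (exp v * (1 - v) <= (1 + v + 8 / 5 * v ^ 2) * (1 - v))%R by nra.
by move=> /(Rmult_le_reg_r); apply; lra.
Qed.

(** Both Chernoff tails and the union bound come from one pointwise inequality: the indicator of the
    good event is at least 1 minus two exponentials. *)
Lemma unif_concentration (eps : R) : (0 < eps < 1)%R ->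
  let mu := (q * INR (size L))%R in
  (1 - 2 * exp (- (5 / 32 * eps ^ 2 * mu / INR K))
   <= unif k s (fun A => INR (Rltb (Rabs (X A - mu)) (eps * mu))))%R.
Proof.
move=> eps01 mu.
have Kpos : (0 < INR K)%R by apply: lt_0_INR; apply/ltP.
have mu0 : (0 <= mu)%R by apply: Rmult_le_pos (incl_prob_ge0 _ _ _) (pos_INR _).
(* With [z = INR K * u], this minimises [8 / 5 * z ^ 2 - eps * z], the exponent left by the
   quadratic bound in units of [mu / INR K]; the minimum is [- 5 / 32 * eps ^ 2]. *)
pose u := (5 / 16 * eps / INR K)%R.
have u0 : (0 < u)%R by apply: Rdiv_lt_0_compat; lra.
(* The upper tail is [w = u], [c = - eps]; the lower one is [w = - u], [c = eps]. *)
have tail (w c : R) : (w ^ 2 = u ^ 2)%R -> (w * c = - (u * eps))%R ->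
    (unif k s (fun A => exp (w * (X A - mu) + (w * c * mu)))
     <= exp (- (5 / 32 * eps ^ 2 * mu / INR K)))%R.
  move=> w2 wc; rewrite wc.
  rewrite (unif_ext _ _ (g := fun A =>
     exp (- w * mu - u * eps * mu) * exp (w * X A))%R); last first.
    by move=> A; rewrite -exp_plus; congr exp; ring.
  rewrite unifZ; apply: Rle_trans (Rmult_le_compat_l _ _ _ _ (unif_mgf w)) _.
    by apply: Rlt_le; apply: exp_pos.
  rewrite -exp_plus; apply: exp_mono.
  have Ku : (INR K * u = 5 / 16 * eps)%R by rewrite /u; field; lra.
  have Kw2 : ((INR K * w) ^ 2 = (5 / 16 * eps) ^ 2)%R by rewrite Rpow_mult_distr w2 -Ku; ring.
  have Kw : (INR K * w <= 3 / 8)%R by nra.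
  have := exp_quadratic_bound Kw; rewrite Kw2 => eb.
  have -> : (- w * mu - u * eps * mu + INR (size L) / INR K * (q * (exp (INR K * w) - 1))
             = mu / INR K * (exp (INR K * w) - 1 - INR K * w - (INR K * u) * eps))%R.
    by rewrite /mu; field; lra.
  have -> : (- (5 / 32 * eps ^ 2 * mu / INR K) = mu / INR K * (- (5 / 32 * eps ^ 2)))%R.
    by field; lra.
  apply: Rmult_le_compat_l; first by apply: Rle_mult_inv_pos.
  by rewrite Ku; nra.
have up := tail u (- eps)%R erefl ltac:(ring).
have lo := tail (- u)%R eps ltac:(ring) ltac:(ring).
have [_ ks] := andP jks.
apply: (@Rle_trans _ (unif k s (fun A => 1 + (-1) *
   (exp (u * (X A - mu) + u * - eps * mu) + exp (- u * (X A - mu) + - u * eps * mu))))%R).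
  by rewrite unifD unif_const unifZ unifD; lra.
apply: unif_le => // A _ _.
have e1 := exp_pos (u * (X A - mu) + u * - eps * mu).
have e2 := exp_pos (- u * (X A - mu) + - u * eps * mu).
rewrite /Rltb; case: Rlt_dec => [lt|/Rnot_lt_le] /=; rewrite ?INR_1 ?INR_0; first lra.
rewrite /Rabs; case: Rcase_abs => sg h.
  have : (1 <= exp (- u * (X A - mu) + - u * eps * mu))%R; last lra.
  by rewrite -exp_0; apply: exp_mono; nra.
have : (1 <= exp (u * (X A - mu) + u * - eps * mu))%R; last lra.
by rewrite -exp_0; apply: exp_mono; nra.
Qed.

End Concentration.

(** * Triangles and the reservoir *)

Lemma norm_edgeC x y : norm_edge (x, y) = norm_edge (y, x).
Proof. by rewrite /norm_edge /= minnC maxnC. Qed.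

Lemma norm_edge_lt x y : (x < y)%N -> norm_edge (x, y) = (x, y).
Proof. by move=> xy; rewrite /norm_edge /=; congr pair; lia. Qed.

Lemma norm_edge_eqP (e : edge) x y :
  reflect (e = (x, y) \/ e = (y, x)) (norm_edge e == norm_edge (x, y)).
Proof.
case: e => u v; apply: (iffP eqP) => [[h1 h2]|[] -> //]; last exact: norm_edgeC.
move: h1 h2; rewrite /= => h1 h2.
have : u = x /\ v = y \/ u = y /\ v = x by lia.
by case=> -[-> ->]; [left|right].
Qed.

Lemma edge_inE (S : seq edge) x y :
  edge_in S x y = (norm_edge (x, y) \in map norm_edge S).
Proof.
apply/orP/mapP => [[h|h]|[e eS /esym/eqP /norm_edge_eqP [] h]].
- by exists (x, y).
- by exists (y, x); rewrite // norm_edgeC.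
- by left; rewrite -h.
- by right; rewrite -h.
Qed.

Lemma edge_inC (S : seq edge) x y : edge_in S x y = edge_in S y x.
Proof. by rewrite /edge_in orbC. Qed.

Lemma edge_in_verts (S : seq edge) x y : edge_in S x y -> x \in verts S.
Proof.
rewrite mem_undup => h; apply/flattenP.
by case/orP: h => h; [exists [:: x; y]|exists [:: y; x]];
  rewrite ?inE ?eqxx ?orbT //; apply/mapP; [exists (x, y)|exists (y, x)].
Qed.

Lemma edge_in_neq (S : seq edge) x y : wf_stream S -> edge_in S x y -> x != y.
Proof.
by case/andP => /allP h _ /orP [/h|/h] //=; rewrite eq_sym.
Qed.

Lemma wf_stream_subseq (A S : seq edge) : subseq A S -> wf_stream S -> wf_stream A.
Proof.
move=> sA /andP [/allP nl un]; apply/andP; split.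
  by apply/allP => e /(mem_subseq sA); apply: nl.
exact: subseq_uniq (map_subseq _ sA) un.
Qed.

Lemma commonC (S : seq edge) u v : common S u v = common S v u.
Proof. by apply: eq_count => c; rewrite andbC. Qed.

Definition is_triangle (S : seq edge) (x : nat * (nat * nat)) : bool :=
  let: (a, (b, c)) := x in
  [&& a < b, b < c, edge_in S a b, edge_in S b c & edge_in S a c]%N.

Definition triangles (S : seq edge) : seq (nat * (nat * nat)) :=
  let V := verts S in
  filter (is_triangle S) [seq (a, bc) | a <- V, bc <- [seq (b, c) | b <- V, c <- V]].

Lemma num_triE (S : seq edge) : num_tri S = size (triangles S).
Proof. by rewrite size_filter. Qed.

Lemma mem_triangles (S : seq edge) x : (x \in triangles S) = is_triangle S x.
Proof.
rewrite mem_filter; case: x => a [b c]; case h: (is_triangle _ _) => //=.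
move: h => /and5P [_ _ ab bc _].
apply: allpairs_f; first exact: edge_in_verts ab.
apply: allpairs_f; first exact: edge_in_verts bc.
by apply: (@edge_in_verts _ _ b); rewrite edge_inC.
Qed.

Lemma triangles_uniq (S : seq edge) : uniq (triangles S).
Proof.
apply: filter_uniq; apply: allpairs_uniq; rewrite ?undup_uniq //.
- by apply: allpairs_uniq; rewrite ?undup_uniq // => -[? ?] [? ?].
- by move=> [? ?] [? ?].
Qed.

(** For [a < b < c] these pairs are already normalised, so they can be looked up directly in
    [map norm_edge S]. *)
Definition tri_edges (x : nat * (nat * nat)) : seq edge :=
  let: (a, (b, c)) := x in [:: (a, b); (b, c); (a, c)].

Lemma tri_edges_inj : injective tri_edges.
Proof. by move=> [a [b c]] [a' [b' c']] [-> -> _ ->]. Qed.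

Lemma is_triangleE (S : seq edge) a b c :
  is_triangle S (a, (b, c)) =
  [&& a < b, b < c & all (mem (map norm_edge S)) (tri_edges (a, (b, c)))]%N.
Proof.
rewrite /is_triangle; have [ab|//] := boolP (a < b)%N; have [bc|//] := boolP (b < c)%N.
by rewrite /= !edge_inE !norm_edge_lt ?andbT // (ltn_trans ab bc).
Qed.

(** Gives the counter the form required by the concentration bound: the family of edge triples is
    fixed by [S], and only the membership test depends on the sample [A]. *)
Lemma num_tri_sub (A S : seq edge) : {subset A <= S} ->
  num_tri A = count (all (mem (map norm_edge A))) (map tri_edges (triangles S)).
Proof.
move=> AS; rewrite num_triE count_map -size_filter; apply: perm_size.
apply: uniq_perm; rewrite ?triangles_uniq ?(filter_uniq _ (triangles_uniq _)) // => -[a [b c]].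
rewrite mem_triangles mem_filter mem_triangles !is_triangleE /=.
have sub e : e \in map norm_edge A -> e \in map norm_edge S.
  by move=> /mapP [e' e'A ->]; apply: map_f; apply: AS.
case h: ((a, b) \in map _ A); last by rewrite !andbF.
case h': ((b, c) \in map _ A); last by rewrite !andbF.
case h'': ((a, c) \in map _ A); last by rewrite !andbF.
by rewrite !sub.
Qed.

(* The ordered triple with vertex set {x, y, w}, for [x < y]. *)
Definition sort3 x y w : nat * (nat * nat) :=
  if (w < x)%N then (w, (x, y)) else if (w < y)%N then (x, (w, y)) else (x, (y, w)).

(** The third vertex determines the triangle: [sort3 x y] is a bijection from the common neighbours,
    which differ from [x] and [y] as there are no loops. *)
Lemma count_triangles_edge (S : seq edge) x y :
  wf_stream S -> (x < y)%N -> edge_in S x y ->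
  count (fun t => (x, y) \in tri_edges t) (triangles S) = common S x y.
Proof.
move=> wS xy exy; rewrite /common -!size_filter.
set C := filter _ (verts S).
have memC w : (w \in C) = edge_in S w x && edge_in S w y.
  by rewrite mem_filter; case h: (edge_in S w x) => //=; rewrite (edge_in_verts h) andbT.
have neq w : w \in C -> w != x /\ w != y.
  by rewrite memC => /andP [/(edge_in_neq wS) -> /(edge_in_neq wS) ->].
rewrite -(size_map (sort3 x y) C); apply: perm_size; apply: uniq_perm.
- by rewrite (filter_uniq _ (triangles_uniq _)).
- rewrite map_inj_in_uniq ?filter_uniq ?undup_uniq // => w w' /neq [/eqP n1 /eqP n2] /neq [/eqP n3 /eqP n4].
  rewrite /sort3; case: ltnP => h1; case: ltnP => h2;
    do ?[case: ltnP => h3]; do ?[case: ltnP => h4]; case; lia.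
move=> t; rewrite mem_filter mem_triangles; apply/idP/mapP.
  case: t => a [b c] /andP [] /=; rewrite !inE => xyt /and5P [ab bc eab ebc eac].
  case/or3P: xyt => /eqP [hx hy]; subst.
  - exists c; first by rewrite memC !(edge_inC _ c) eac ebc.
    by rewrite /sort3 !ltnNge (ltnW bc) (ltnW (ltn_trans ab bc)).
  - by exists a; [rewrite memC eab eac|rewrite /sort3 ab].
  - exists b; first by rewrite memC ebc edge_inC eab.
    by rewrite /sort3 ltnNge (ltnW ab) bc.
move=> [w wC ->]; have [/eqP wx /eqP wy] := neq _ wC; move: wC; rewrite memC => /andP [ewx ewy].
rewrite /sort3; case: ltnP => h1; first by rewrite /= !inE !eqxx ?orbT h1 xy ewx ewy exy.
case: ltnP => h2 /=; rewrite !inE !eqxx ?orbT /= (edge_inC _ x w) ewx exy ?(edge_inC _ y w) ewy /=;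
  by lia.
Qed.

(** An edge does not join its own endpoints to a third vertex. This reconciles [rem_at], which
    counts after the removal, with [num_tri_insert], which counts while the edge is present. *)
Lemma common_insert (S1 S2 : seq edge) (f : edge) : wf_stream (S1 ++ f :: S2) ->
  common (S1 ++ f :: S2) f.1 f.2 = common (S1 ++ S2) f.1 f.2.
Proof.
set S := S1 ++ f :: S2; set S' := S1 ++ S2 => wS.
pose p := norm_edge f.
have memS e : (e \in map norm_edge S) = (e == p) || (e \in map norm_edge S').
  by rewrite /S /S' !map_cat /= !mem_cat in_cons orbCA.
rewrite /common -!size_filter; apply: perm_size; apply: uniq_perm;
  rewrite ?filter_uniq ?undup_uniq // => w.
have red X : (w \in [seq c <- verts X | edge_in X c f.1 && edge_in X c f.2])
             = edge_in X w f.1 && edge_in X w f.2.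
  by rewrite mem_filter; case h: (edge_in X w f.1) => //=; rewrite (edge_in_verts h) andbT.
rewrite !red.
have wS' : wf_stream S'.
  by apply: wf_stream_subseq wS; apply: cat_subseq => //; apply: subseq_cons.
have irr X : wf_stream X -> edge_in X w w = false.
  by move=> wX; apply/negP => /(edge_in_neq wX); rewrite eqxx.
case: (eqVneq w f.1) => [<-|n1]; first by rewrite !irr.
case: (eqVneq w f.2) => [<-|n2]; first by rewrite !irr ?andbF.
have fE : f = (f.1, f.2) by case: (f).
have np z : norm_edge (w, z) == p = false.
  by apply/negP; rewrite eq_sym => /norm_edge_eqP [] h; move: n1 n2; rewrite h eqxx.
by rewrite !edge_inE !memS !np.
Qed.

(** Triangles are split by whether they contain the normalised edge [p]: those that avoid it live in
    the rest, the others correspond to common neighbours of its endpoints. *)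
Lemma num_tri_insert (S1 S2 : seq edge) (f : edge) : wf_stream (S1 ++ f :: S2) ->
  num_tri (S1 ++ f :: S2) = (num_tri (S1 ++ S2) + common (S1 ++ f :: S2) f.1 f.2)%N.
Proof.
set S := S1 ++ f :: S2; set S' := S1 ++ S2 => wS.
pose p := norm_edge f.
have memS e : (e \in map norm_edge S) = (e == p) || (e \in map norm_edge S').
  by rewrite /S /S' !map_cat /= !mem_cat in_cons orbCA.
have pS' : p \notin map norm_edge S'.
  have /andP [_] := wS; rewrite /S map_cat /= -cat1s uniq_catCA cat1s /=.
  by rewrite /S' map_cat => /andP [].
have f12 : f.1 != f.2.
  by have /andP [/allP h _] := wS; apply: h; rewrite mem_cat mem_head orbT.
have pE : p = norm_edge (p.1, p.2) by rewrite /p /norm_edge /=; congr pair; lia.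
have p12 : (p.1 < p.2)%N by move: f12; rewrite /p /norm_edge /=; lia.
have eS : edge_in S p.1 p.2 by rewrite edge_inE -pE memS eqxx.
rewrite num_triE -(count_predC (fun t => p \in tri_edges t)) addnC; congr addn.
  rewrite num_triE -size_filter; apply: perm_size; apply: uniq_perm.
  - by rewrite (filter_uniq _ (triangles_uniq _)).
  - exact: triangles_uniq.
  move=> [a [b c]]; rewrite mem_filter !mem_triangles !is_triangleE /= !inE !memS !(eq_sym p).
  case: ((a, b) =P p) => [->|_]; first by rewrite (negbTE pS') /= !andbF.
  case: ((b, c) =P p) => [->|_]; first by rewrite (negbTE pS') /= !andbF.
  by case: ((a, c) =P p) => [->|_]; first by rewrite (negbTE pS') /= !andbF.
have := count_triangles_edge wS p12 eS; rewrite -surjective_pairing => ->.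
rewrite /p /norm_edge /=; have [h|h] := leqP f.1 f.2; first by [].
exact: commonC.
Qed.

(** * The law of the reservoir and of its counter *)

Definition dexp (d : Defs.dist) (F : state -> R) : R := \rsum_(x <- d) (x.1 * F x.2).

Lemma probE (d : Defs.dist) P : prob d P = dexp d (fun st => INR (P st)).
Proof.
rewrite /prob /dexp; elim: d => [|x d IH]; first by rewrite big_nil.
rewrite big_cons [LHS]/= IH; congr Rplus.
by case: (P _); rewrite ?INR_1 ?INR_0; ring.
Qed.

Lemma dexp_cons w st (d : Defs.dist) F : dexp ((w, st) :: d) F = (w * F st + dexp d F)%R.
Proof. by rewrite /dexp big_cons. Qed.

Lemma dexp_step M t e d F :
  dexp (step M t e d) F = dexp d (fun st => dexp (step1 M t e st) F).
Proof.
elim: d => [|[w st] d IH]; first by rewrite /dexp !big_nil.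
rewrite dexp_cons -IH /dexp /step [flatten _]/= big_cat big_map /= -rsum_scal.
by congr Rplus; apply: eq_bigr => x _ /=; ring.
Qed.

Lemma run_from_rcons M t s e d :
  run_from M t (rcons s e) d = step M (t + size s).+1 e (run_from M t s d).
Proof.
elim: s t d => [|x s IH] t d /=; first by rewrite addn0.
by rewrite IH addSnnS.
Qed.

(** Induction on the stream from its end, for all [F] at once because a step changes the test
    function. After an overflow the new edge enters with probability [M / t], and the random
    eviction turns the old [M]-subset into a uniform [M.-1]-subset, as [unif_insert] demands. *)
Lemma triest_base_unif M (s : seq edge) (F : state -> R) : (0 < M)%N -> wf_stream s ->
  dexp (triest_base M s) F
  = unif (minn M (size s)) s (fun A => F (A, INR (num_tri A))).
Proof.
move=> M0; elim/last_ind: s F => [|s e IH] F ws.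
  transitivity (1 * F ([::], 0%R) + 0)%R; first by rewrite [LHS]big_cons big_nil.
  by rewrite [unif _ _ _]/= (_ : num_tri [::] = 0%N) // INR_0 Rmult_1_l Rplus_0_r.
rewrite /triest_base run_from_rcons add0n dexp_step.
have {}IH G := IH G (wf_stream_subseq (subseq_rcons s e) ws).
rewrite -/(triest_base M s) {}IH size_rcons.
pose f (A : seq edge) := F (A, INR (num_tri A)).
have insE A : subseq A s ->
    ins e (A, INR (num_tri A)) = (rcons A e, INR (num_tri (rcons A e))).
  move=> sA; have wA : wf_stream (A ++ [:: e]).
    by rewrite cats1; apply: wf_stream_subseq ws; rewrite -!cats1 cat_subseq.
  by rewrite /ins /= -cats1 (num_tri_insert wA) cats0 plus_INR.
have insertE k : (k <= (size s).+1)%N ->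
   unif k (rcons s e) f = (INR k / INR (size s).+1 * unif k.-1 s (fun A => f (rcons A e))
     + (1 - INR k / INR (size s).+1) * unif k s f)%R.
  move=> ks; rewrite -cats1 (@unif_insert _ k s e [::] f (fun A => f (rcons A e))) ?cats0 ?addn0 //.
  by move=> A1 A2 _; rewrite subseq0 => /eqP ->; rewrite cats0 cats1.
have n0 : INR (size s).+1 <> 0%R by apply: not_0_INR.
case: (leqP (size s).+1 M) => sM.
  rewrite (minn_idPr (ltnW sM)) insertE // Rdiv_diag // succnK.
  rewrite (@unif_eq _ (size s) s _ (fun A => f (rcons A e))) //; first by ring.
  by move=> A sA _; rewrite /step1 sM /= dexp_cons insE // /dexp big_nil Rmult_1_l Rplus_0_r.
rewrite insertE; last exact: ltnW.
move: sM; rewrite ltnS => sM; rewrite (minn_idPl sM).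
have M0' : INR M <> 0%R by apply: not_0_INR; lia.
(* Each position is evicted with probability [M / t * (1 / M) = 1 / t], so the evictions form the
   sum in [unif_delete]. *)
rewrite (@unif_eq _ M s _ (fun A => (1 - INR M / INR (size s).+1) * f A
   + / INR (size s).+1 * \rsum_(i <- iota 0 (size A)) f (rcons (take i A ++ drop i.+1 A) e))%R) //.
  rewrite unifD !unifZ; case: M M0 sM {insertE M0'} => // M _ sM.
  by rewrite (unif_delete (fun A => f (rcons A e)) sM) succnK; field.
move=> A sA szA; rewrite /step1 ltnNge sM /= dexp_cons; congr Rplus.
rewrite /dexp big_map -rsum_scal; apply: eq_big_seq => i; rewrite mem_iota add0n /= => iA.
have AE := drop_nth (0, 0) iA.
have sD : subseq (take i A ++ drop i.+1 A) A.
  rewrite -{3}(cat_take_drop i A) AE; apply: cat_subseq => //; exact: subseq_cons.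
have wA : wf_stream (take i A ++ nth (0, 0) A i :: drop i.+1 A).
  rewrite -AE cat_take_drop; apply: wf_stream_subseq ws.
  exact: subseq_trans sA (subseq_rcons s e).
have remE : rem_at i (A, INR (num_tri A))
    = (take i A ++ drop i.+1 A, INR (num_tri (take i A ++ drop i.+1 A))).
  rewrite /rem_at /=; congr pair; rewrite -{1}(cat_take_drop i A) AE.
  by rewrite (num_tri_insert wA) plus_INR (common_insert wA); apply: Rplus_minus_r.
rewrite remE insE; last exact: subseq_trans sD sA.
rewrite szA.
have -> // : (INR M / INR (size s).+1 * (1 / INR M) = / INR (size s).+1)%R by field.
Qed.

Lemma common_le_hmax (S : seq edge) x y : edge_in S x y -> (common S x y <= hmax S)%N.
Proof.
have le e : e \in S -> (common S e.1 e.2 <= hmax S)%N.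
  rewrite /hmax -[common S _ _]/(tri_of_edge S e).
  move: (tri_of_edge S) => g; elim: S => //= e' S IH; rewrite in_cons.
  by case/orP => [/eqP ->|/IH h]; rewrite leq_max ?leqnn // h orbT.
by case/orP => /le //=; rewrite commonC.
Qed.

(** A conflicting triangle contains one of the three edges of [l], each of which lies in at most
    [hmax S] triangles; the union bound adds these up. *)
Lemma triangle_degree (S : seq edge) (l : seq edge) : wf_stream S ->
  l \in map tri_edges (triangles S) ->
  (count (fun l' => has (mem l) l') (map tri_edges (triangles S)) <= 3 * hmax S)%N.
Proof.
move=> wS /mapP [[a [b c]]]; rewrite mem_triangles => /and5P [ab bc eab ebc eac] ->.
rewrite count_map.
have deg x y : (x < y)%N -> edge_in S x y ->
    (count (fun t => (x, y) \in tri_edges t) (triangles S) <= hmax S)%N.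
  by move=> xy exy; rewrite count_triangles_edge //; apply: common_le_hmax.
have := deg _ _ ab eab; have := deg _ _ bc ebc; have := deg _ _ (ltn_trans ab bc) eac.
set p1 := (fun t => (a, c) \in _); set p2 := (fun t => (b, c) \in _).
set p3 := (fun t => (a, b) \in _) => h1 h2 h3.
rewrite (eq_count (a2 := predU p3 (predU p2 p1))); last first.
  by move=> t; rewrite /= has_sym /= orbF.
have := count_predUI p3 (predU p2 p1) (triangles S).
have := count_predUI p2 p1 (triangles S); lia.
Qed.

(** * Numerical estimate of the failure probability, and conclusion *)

Lemma sample_size_bound (m t T K eps delta : R) :
  (25 <= m)%R -> (m <= t)%R -> (0 < T)%R -> (1 <= K)%R -> (0 < eps < 1)%R -> (0 < delta < 1)%R ->
  (t * Rpower (8 / eps ^ 2 * (K / T) * ln (K * exp 1 / delta)) (1 / 3) <= m)%R ->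
  (2 * exp (- (5 / 32 * eps ^ 2 * (m / t * ((m - 1) / (t - 1) * ((m - 2) / (t - 2) * 1)) * T) / K))
   < delta)%R.
Proof.
move=> m25 mt T0 K1 eps01 del01.
have e2 : (2 < exp 1)%R by have := exp_ineq1 1; lra.
have Ked : (1 < K * exp 1 / delta)%R.
  by apply: (Rmult_lt_reg_r delta); [lra|rewrite /Rdiv Rmult_assoc Rinv_l; nra].
set l := ln (K * exp 1 / delta).
have l0 : (0 < l)%R by rewrite /l -ln_1; apply: ln_increasing; lra.
set x := (8 / eps ^ 2 * (K / T) * l)%R.
have ee : (0 < eps ^ 2)%R by nra.
have x0 : (0 < x)%R.
  by apply: Rmult_lt_0_compat => //; apply: Rmult_lt_0_compat; apply: Rdiv_lt_0_compat; lra.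
set Phi := Rpower x (1 / 3) => tPhi.
have Phi0 : (0 < Phi)%R by apply: exp_pos.
have Phi3 : (Phi ^ 3 = x)%R.
  rewrite -Rpower_pow // /Phi Rpower_mult.
  have -> : (1 / 3 * INR 3 = 1)%R by rewrite /INR; field.
  exact: Rpower_1.
set q := (m / t * _)%R.
(* For [m >= 25], [(m - 1) * (m - 2) >= 88 / 100 * m ^ 2] (at 25: 552 against 550), and the
   denominator is at most [t ^ 3]. *)
have qx : (88 / 100 * x <= q)%R.
  apply: (@Rle_trans _ (88 / 100 * (m / t) ^ 3)).
    rewrite -Phi3; apply: Rmult_le_compat_l; first lra.
    apply: pow_incr; split; first lra.
    by apply: (Rmult_le_reg_r t); [lra|rewrite /Rdiv Rmult_assoc Rinv_l; lra].
  have -> : q = ((m * ((m - 1) * (m - 2))) / (t * ((t - 1) * (t - 2))))%R.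
    by rewrite /q; field; lra.
  apply: (@Rle_trans _ ((m * ((m - 1) * (m - 2))) / t ^ 3)).
    have -> : (88 / 100 * (m / t) ^ 3 = (m * (88 / 100 * m ^ 2)) / t ^ 3)%R by field; lra.
    apply: Rmult_le_compat_r; first by apply: Rlt_le; apply: Rinv_0_lt_compat; apply: pow_lt; lra.
    by apply: Rmult_le_compat_l; nra.
  apply: Rmult_le_compat_l; first by apply: Rmult_le_pos; nra.
  apply: Rinv_le_contravar; first by apply: Rmult_lt_0_compat; nra.
  by rewrite /= Rmult_1_r; apply: Rmult_le_compat_l; nra.
have ex : (l <= 5 / 32 * eps ^ 2 * (q * T) / K)%R.
  apply: (@Rle_trans _ (5 / 32 * eps ^ 2 * (88 / 100 * x * T) / K)).
    (* [5 / 32 * 8 * 88 / 100 = 11 / 10]: the 8 in [Phi] leaves a little room above [l]. *)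
    have -> : (5 / 32 * eps ^ 2 * (88 / 100 * x * T) / K = 11 / 10 * l)%R.
      by rewrite /x; field; lra.
    by lra.
  apply: Rmult_le_compat_r; first by apply: Rlt_le; apply: Rinv_0_lt_compat; lra.
  by apply: Rmult_le_compat_l; [lra|apply: Rmult_le_compat_r; lra].
(* [exp (- l)] is [delta / (K * exp 1)], and twice this is below [delta] because [exp 1 > 2] and
   [K >= 1]. *)
apply: (@Rle_lt_trans _ (2 * exp (- l))).
  by apply: Rmult_le_compat_l; [lra|apply: exp_mono; lra].
rewrite exp_Ropp exp_ln; last lra.
have -> : (2 * / (K * exp 1 / delta) = delta * (2 / (K * exp 1)))%R.
  by field; split; [lra|split; lra].
have : (2 / (K * exp 1) < 1)%R; last nra.
by apply: (Rmult_lt_reg_r (K * exp 1)); [nra|rewrite /Rdiv Rmult_assoc Rinv_l; nra].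
Qed.

Lemma Rltb_scale q x y : (0 < q)%R -> Rltb (q * x) (q * y) = Rltb x y.
Proof.
by move=> q0; rewrite /Rltb; case: Rlt_dec => h; case: Rlt_dec => h' //; nra.
Qed.

Theorem theorem4p5 (M : nat) (s : seq edge) (eps delta : R) :
  (6 <= M)%N -> wf_stream s -> (0 < num_tri s)%N ->
  (0 < eps < 1)%R -> (0 < delta < 1)%R ->
  let t := size s in
  let T := INR (num_tri s) in
  let h := INR (hmax s) in
  let Phi := Rpower (8 / eps ^ 2 * ((3 * h + 1) / T)
                      * ln ((3 * h + 1) * exp 1 / delta)) (1 / 3) in
  (Rmax (INR t * Phi * (1 + 1 / 2 * Rpower (ln (INR t * Phi)) (2 / 3)))
        (Rmax (12 / eps + exp 1 ^ 2) 25) <= INR M)%R ->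
  (prob (triest_base M s)
        (fun st => Rltb (Rabs (xi M t * st.2 - T)) (eps * T))
   > 1 - delta)%R.
Proof.
move=> M6 ws T0 eps01 del01 t T h Phi hM.
have Tpos : (0 < T)%R by apply: lt_0_INR; apply/ltP.
have h0 : (0 <= h)%R by apply: pos_INR.
rewrite probE triest_base_unif -/t; [|by lia|by []].
case: (leqP t M) => tM.
  (* The sample is the whole stream and [xi] is 1, so the error vanishes. *)
  rewrite unif_full /= /xi /xi_ab tM -/T Rmult_1_l Rminus_diag Rabs_R0.
  by rewrite /Rltb; case: Rlt_dec => [lt|[]] /=; [rewrite INR_1; lra|nra].
have [hM1 hM2] : (INR t * Phi <= INR M)%R /\ (25 <= INR M)%R.
  have tP : (0 <= INR t * Phi)%R by apply: Rmult_le_pos (pos_INR _) (Rlt_le _ _ (exp_pos _)).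
  (* [Rpower] is an exponential, hence positive even if the logarithm inside is not; the correction
     factor is therefore at least 1. *)
  have r0 : (0 < Rpower (ln (INR t * Phi)) (2 / 3))%R by apply: exp_pos.
  have := Rle_trans _ _ _ (Rmax_r _ _) (Rle_trans _ _ _ (Rmax_r _ _) hM).
  have := Rle_trans _ _ _ (Rmax_l _ _) hM; nra.
have hMt : (INR M <= INR t)%R by apply: INR_leq; apply: ltnW.
pose L := map tri_edges (triangles s).
pose K := (3 * hmax s).+1.
have KE : INR K = (3 * h + 1)%R by rewrite S_INR mult_INR /h; congr (_ * _ + _)%R; rewrite /INR; ring.
have szL : size L = num_tri s by rewrite size_map num_triE.
have [_ us] := andP ws.
pose q := incl_prob 3 M (size (map norm_edge s)).
have qE : q = (INR M / INR t * ((INR M - 1) / (INR t - 1) * ((INR M - 2) / (INR t - 2) * 1)))%R.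
  rewrite /q size_map /= -/t; move: t M M6 tM {hM hM1 hM2 hMt Phi q} => t M M6 tM.
  case: M M6 tM => [|[|M]] //; case: t => [|[|t]] // _ _ /=.
  by rewrite !S_INR; congr (_ * (_ / _ * (_ / _ * _)))%R; ring.
(* The scaling factor is the inverse of the probability that a given triangle is sampled, so [q * T]
   is the mean of the counter. *)
have xiE : xi M t = (/ q)%R.
  rewrite qE /xi /xi_ab leqNgt tM /= !subn0 !minus_INR; try by apply/leP; lia.
  have -> : INR 2 = 2%R by rewrite /INR; ring.
  by rewrite INR_1; field; lra.
have q0 : (0 < q)%R.
  rewrite qE Rmult_1_r; apply: Rmult_lt_0_compat; last apply: Rmult_lt_0_compat;
    apply: Rdiv_lt_0_compat; lra.
have jks : (3 <= M <= size (map norm_edge s))%N by rewrite size_map (ltnW tM) andbT; lia.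
have uL : uniq L by rewrite (map_inj_uniq tri_edges_inj) triangles_uniq.
have hL l : l \in L -> [/\ uniq l, {subset l <= map norm_edge s} & size l = 3].
  move=> /mapP [[a [b c]]]; rewrite mem_triangles is_triangleE.
  move=> /and3P [ab bc /allP sub] -> {l}; split=> //=.
  by rewrite !inE !xpair_eqE; lia.
have degL l : l \in L -> (count (fun l' => has (mem l) l') L <= K)%N.
  by move=> lL; apply: leqW; apply: triangle_degree.
have conc := unif_concentration us jks isT (isT : (0 < K)%N) uL hL degL eps01.
cbv zeta in conc; rewrite unif_map -/q szL -/T KE in conc.
apply: Rlt_gt; apply: Rlt_le_trans (Rle_trans _ _ _ conc _).
  have := sample_size_bound hM2 hMt Tpos _ eps01 del01 hM1.
  by rewrite -qE => /(_ ltac:(lra)); lra.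
apply: Req_le; apply: unif_eq; first exact: ltnW.
(* Multiplying both sides of the target inequality by [q] turns it into the deviation of the counter
   from [q * T]. *)
move=> A sA _; congr INR; congr nat_of_bool; rewrite /= (num_tri_sub (mem_subseq sA)) -/L.
rewrite -[RHS](Rltb_scale _ _ q0) xiE; congr Rltb; last by ring.
have aq : Rabs q = q by apply: Rabs_pos_eq; lra.
rewrite -[X in _ = (X * _)%R]aq -Rabs_mult Rmult_minus_distr_l -Rmult_assoc.
by rewrite Rinv_r ?Rmult_1_l //; lra.
Qed.
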